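(* For each even integer $n\geq 8$ there exists a $4$-regular circulant nut graph of order $n$.
   Context: A circulant graph of order $n$ is a graph of the form $\mathrm{Circ}(n,S)$ with generator set $S\subseteq\{1,\dots,\lfloor n/2\rfloor\}$, i.e. the graph with vertex set $V=\{0,1,\dots,n-1\}$ in which $i$ is adjacent to $i\pm s$ (computed modulo $n$) for every $i\in V$ and $s\in S$. A simple graph with at least two vertices is a nut graph if its adjacency matrix has the eigenvalue $0$ with multiplicity exactly $1$ and an eigenvector corresponding to $0$ has no zero entries. *)

(* Defs.v *)
From mathcomp Require Import all_boot all_order all_algebra.
From mathcomp Require Import reals.

Set Implicit Arguments.
Unset Strict Implicit.
Unset Printing Implicit Defensive.

Import GRing.Theory.

Local Open Scope nat_scope.

(* A graph of order n is an adjacency relation on the vertex set 'I_n. *)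
Definition simple_graph (n : nat) (e : rel 'I_n) : Prop :=
  symmetric e /\ irreflexive e.

Definition regular (n k : nat) (e : rel 'I_n) : Prop :=
  forall i : 'I_n, #|[set j | e i j]| = k.

(* S is a subset of {1, ..., floor(n/2)}; no generality is lost by taking S in
   {set 'I_n}, as n./2 < n whenever n > 0. *)
Definition generator_set (n : nat) (S : {set 'I_n}) : Prop :=
  forall s : 'I_n, s \in S -> 1 <= s <= n./2.

(* i is adjacent to j iff j = i + s or j = i - s modulo n for some s in S; the
   second equation is written j + s = i, as subtraction on nat is truncated. *)
Definition Circ (n : nat) (S : {set 'I_n}) : rel 'I_n :=
  fun i j => [exists s in S, (j == i + s %[mod n]) || (j + s == i %[mod n])].

Definition circulant (n : nat) (e : rel 'I_n) : Prop :=
  exists2 S : {set 'I_n}, generator_set S & e =2 Circ S.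

Local Open Scope ring_scope.

Definition adjacency_mx (R : realType) (n : nat) (e : rel 'I_n) : 'M[R]_n :=
  \matrix_(i, j) (e i j)%:R.

(* The multiplicity of the eigenvalue 0 is its multiplicity as a root of the
   characteristic polynomial.  The library's eigenspaces consist of row vectors,
   which is immaterial here as the adjacency matrix is symmetric. *)
Definition nut_graph (R : realType) (n : nat) (e : rel 'I_n) : Prop :=
  let A := adjacency_mx R e in
  [/\ simple_graph e,
      (2 <= n)%N,
      mup 0 (char_poly A) = 1%N
    & exists v : 'rV[R]_n,
        [/\ (v <= eigenspace A 0)%MS, v != 0 & forall i, v 0 i != 0]].

(* Main.v *)
(** Write n = 2m.  The graph Circ(n, {s, s+1}) has adjacency operator
    P^-(s+1) (1 + P) (1 + P^r), where P is the cyclic shift and r = 2s+1.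
    If r is coprime to n, its kernel is spanned by the alternating vector:
    untwisting by signs turns (1 + P)(1 + P^r) into (1 - P)(1 - P^r), and a
    cyclic sequence with constant r-step differences is r-invariant, hence
    constant.  A suitable s with 1 <= s and s+1 < m exists for m >= 4: take
    r = m - 1 if m is even and r = m - 2 if m is odd. *)
Require Import Defs.
From mathcomp Require Import all_boot all_order all_algebra.
From mathcomp Require Import reals.
From mathcomp Require Import zify ring.

Import GRing.Theory Num.Theory.

Local Open Scope ring_scope.

(** * Characteristic polynomials and the multiplicity of the eigenvalue 0 *)

(** Sylvester's determinant identity: the block matrix with rows [1, w] and [w^T, 'X] is reduced to
    triangular form in two ways, and the determinants are compared. *)
Lemma char_poly_tr_mul_row (F : fieldType) (n : nat) (v : 'rV[F]_n) :
  'X * char_poly (v^T *m v)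
    = ('X - ((v *m v^T) 0 0)%:P) * 'X ^+ n.
Proof.
pose w := map_mx polyC v.
have EJ : char_poly_mx (v^T *m v) = 'X%:M - w^T *m w.
  by rewrite /char_poly_mx map_mxM -map_trmx.
have Ed : w *m w^T = (((v *m v^T) 0 0)%:P)%:M.
  by rewrite [LHS]mx11_scalar map_trmx -map_mxM mxE.
have EL : block_mx 1 w w^T 'X%:M
    = block_mx 1 0 w^T 1%:M *m block_mx 1%:M w 0 ('X%:M - w^T *m w).
  by rewrite mulmx_block ?(mul0mx, mulmx0, mul1mx, mulmx1, addr0, add0r) subrKC.
have ER : block_mx 1 w w^T 'X%:M *m block_mx 'X%:M 0 (- w^T) 1%:M
    = block_mx ('X%:M - w *m w^T) w 0 'X%:M.
  rewrite mulmx_block ?(mul0mx, mulmx0, mul1mx, mulmx1, addr0, add0r).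
  by rewrite !mulmxN mul_mx_scalar mul_scalar_mx subrr.
move: (congr1 determinant ER); rewrite EL !det_mulmx !det_lblock !det_ublock.
rewrite !det1 !det_scalar Ed -raddfB det_scalar1 !mul1r !mulr1 /= => <-.
by rewrite mulrC /char_poly EJ.
Qed.

(* As A and J = v^T v annihilate each other, (X - A)(X - J) = X (X - (A + J)),
   while A + J is invertible. *)
Lemma mup0_char_poly_line_kernel (F : fieldType) (n : nat) (A : 'M[F]_n)
    (v : 'rV[F]_n) :
  A *m v^T = 0 -> (v *m v^T) 0 0 != 0 ->
  (forall u : 'rV[F]_n, u *m A = 0 -> exists c, u = c *: v) ->
  mup 0 (char_poly A) = 1%N.
Proof.
move=> AvT d_neq0 kerA; set d := (v *m v^T) 0 0 in d_neq0.
have vvT : v *m v^T = d%:M by rewrite [LHS]mx11_scalar.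
set J := v^T *m v.
(* If [u] kills [A + J], multiplying by [v^T] removes [A] and leaves [d *: (u *m v^T) = 0]. Hence
   [u *m A = 0], so [u = c *: v], and then [c * d = 0]. *)
have uM : A + J \in unitmx.
  rewrite -row_free_unit; apply: inj_row_free => u uM0.
  have uvT : u *m v^T = 0.
    apply: (@scalerI _ _ d); rewrite // scaler0.
    move/(congr1 (mulmx^~ v^T)): uM0.
    rewrite mul0mx mulmxDr mulmxDl -!mulmxA AvT mulmx0 add0r.
    by rewrite vvT -mul_mx_scalar mulmxA.
  have uA : u *m A = 0.
    by move: uM0; rewrite mulmxDr mulmxA uvT mul0mx addr0.
  have [c Eu] := kerA u uA.
  move: uvT; rewrite Eu -scalemxAl vvT scale_scalar_mx => /(congr1 trmx)/matrixP.
  move=> /(_ 0 0)/eqP; rewrite !mxE eqxx mulr1n mulf_eq0 (negPf d_neq0) orbF.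
  by move=> /eqP->; rewrite scale0r.
have Eprod : char_poly A * char_poly J = 'X ^+ n * char_poly (A + J).
  rewrite /char_poly -det_mulmx -detZ; congr (\det _).
  rewrite /char_poly_mx map_mxD mulmxBr !mulmxBl -map_mxM.
  rewrite mulmxA AvT mul0mx map_mx0 subr0 !mul_scalar_mx mul_mx_scalar.
  by rewrite -!scalerBr opprD addrA.
have Echar : char_poly A * ('X - d%:P) = 'X * char_poly (A + J).
  apply: (@mulfI _ ('X ^+ n)); first by rewrite expf_neq0 ?polyX_eq0.
  rewrite mulrCA [_ * ('X - _)]mulrC -char_poly_tr_mul_row.
  by rewrite mulrCA Eprod mulrCA.
(* Neither ['X - d%:P] nor [char_poly (A + J)] vanishes at 0, so only the factor ['X] counts. *)
have := congr1 (mup 0) Echar.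
rewrite mupMl ?root_XsubC 1?eq_sym // mupMl; last first.
  rewrite /root horner_coef0 char_poly_det mulf_neq0 ?signr_eq0 //.
  by rewrite -unitfE -unitmxE.
by move=> ->; have := mup_XsubCX 1 (0 : F) 0; rewrite subr0 expr1 eqxx.
Qed.

(** * Periodic sequences and the choice of the step *)

Lemma alternating_of_recurrence (R : idomainType) (n r : nat) (f : nat -> R) :
  ~~ odd n -> coprime r n -> n%:R != 0 :> R ->
  (forall k, f (k + n)%N = f k) ->
  (forall k, f k + f k.+1 + f (k + r)%N + f (k + r).+1 = 0) ->
  forall k, f k = (-1) ^+ k * f 0%N.
Proof.
move=> n_even co_rn n_neq0 f_per f_rec.
have n_gt0 : (0 < n)%N by case: n n_neq0 {n_even co_rn f_per}; rewrite ?eqxx.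
have r_odd : odd r.
  have : ~~ (2 %| gcdn r n)%N by rewrite (eqP co_rn).
  by rewrite dvdn_gcd !dvdn2 n_even andbT negbK.
have r_gt0 : (0 < r)%N by case: (r) r_odd.
pose h k := (-1) ^+ k * f k; pose c := f 0%N + f r.
(* The recurrence says that [f k + f (k + r)] changes sign when [k] grows by 1. *)
have g_alt k : f k + f (k + r)%N = (-1) ^+ k * c.
  elim: k => [|k IHk]; first by rewrite mul1r.
  rewrite exprS mulN1r mulNr -IHk; apply/eqP; rewrite -addr_eq0 addSn.
  by rewrite -(f_rec k); apply/eqP; ring.
have h_step k : h (k + r)%N = h k - c.
  rewrite /h exprD -[in (-1) ^+ r]signr_odd r_odd expr1.
  have -> : c = (-1) ^+ k * (f k + f (k + r)%N).
    by rewrite g_alt mulrA -expr2 sqrr_sign mul1r.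
  ring.
have h_steps q k : h (k + q * r)%N = h k - c *+ q.
  elim: q => [|q IHq]; first by rewrite addn0 subr0.
  by rewrite mulSnr addnA h_step IHq mulrSr -addrA -opprD.
have h_per q k : h (k + q * n)%N = h k.
  elim: q => [|q IHq]; first by rewrite addn0.
  by rewrite mulSnr addnA /h f_per exprD -[(-1) ^+ n]signr_odd (negPf n_even)
    mulr1 -/(h _) IHq.
(* After [n] steps of length [r] the sequence [h] is back at its start, so [c *+ n = 0]. *)
have c0 : c = 0.
  have /eqP := h_steps n 0%N; rewrite [(n * r)%N]mulnC h_per.
  rewrite -subr_eq0 subKr -mulr_natr mulf_eq0 (negPf n_neq0) orbF.
  exact: eqP.
have h_const k : h k = h 0%N.
  (* By Bezout [a * r = b * n + 1]: [a] steps of length [r] amount to one unit step modulo [n]. *)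
  elim: k => // k <-; have [a b Eab _] := egcdnP n r_gt0.
  rewrite (eqP co_rn) in Eab.
  have := h_steps a k.
  by rewrite Eab addnA addnAC h_per addn1 c0 mul0rn subr0.
move=> k; have <- : h 0%N = f 0%N by rewrite /h mul1r.
by rewrite -(h_const k) /h mulrA -expr2 sqrr_sign mul1r.
Qed.

Lemma coprime_odd_step (n : nat) : ~~ odd n -> (8 <= n)%N ->
  exists s, [/\ (0 < s)%N, (s.+1 < n./2)%N & coprime s.*2.+1 n].
Proof.
move=> n_even n_ge8; set m := n./2.
have En : n = (m * 2)%N by rewrite /m; lia.
(* An odd number is coprime to [n = 2m] once it is coprime to [m], and subtracting it from [m]
   leaves only [e], which is 1 or 2 below. *)
have key s e : (m = s.*2.+1 + e)%N -> coprime s.*2.+1 e -> coprime s.*2.+1 n.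
  move=> Em co_e; rewrite En coprimeMr coprimen2 /= odd_double andbT Em.
  by rewrite /coprime gcdnDl.
case m_odd: (odd m).
- exists (m - 3)./2; split; [lia | lia |].
  by apply: (key _ 2); rewrite ?coprimen2 /= ?odd_double //; lia.
- exists (m - 2)./2; split; [lia | lia |].
  by apply: (key _ 1%N); rewrite ?coprimen1 //; lia.
Qed.

(** * The circulant graph with two consecutive generators *)

Definition residue (n : nat) (n_gt0 : (0 < n)%N) (k : nat) : 'I_n :=
  Ordinal (ltn_pmod k n_gt0).

Section ConsecutiveGenerators.

Variables (n s : nat).
Hypotheses (n_even : ~~ odd n) (s_gt0 : (0 < s)%N) (s_lt : (s.+1 < n./2)%N).

Let n_gt0 : (0 < n)%N. Proof. by case: (n) s_lt. Qed.

Let vtx := residue n n_gt0.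

Definition consecutive_generators : {set 'I_n} := [set vtx s; vtx s.+1].

Let S := consecutive_generators.

(** The last two entries represent [-(s+1)] and [-s] modulo [n]. *)
Let offsets := [:: s; s.+1; n - s.+1; n - s]%N.

Let neighbours (i : 'I_n) := [seq vtx (i + d) | d <- offsets].

Lemma consecutive_generator_set : generator_set S.
Proof.
move=> t; rewrite !inE => /orP[] /eqP-> /=; rewrite modn_small; lia.
Qed.

(** With neighbours given as a list, regularity follows from the list having no repetitions, and
    products with the adjacency matrix become four-term sums. *)
Lemma Circ_consecutiveE i j : Circ S i j = (j \in neighbours i).
Proof.
have Eplus t : (t < n)%N -> (j == i + vtx t %[mod n]) = (j == vtx (i + t)).
  by move=> t_lt; rewrite -val_eqE /= modnDmr (modn_small (ltn_ord j)).
have Eminus t : (t < n)%N ->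
    (j + vtx t == i %[mod n]) = (j == vtx (i + (n - t))).
  move=> t_lt; rewrite -val_eqE /= -[in RHS](modn_small (ltn_ord j)).
  rewrite -[RHS](eqn_modDr t) -addnA subnK 1?ltnW // modnDr.
  by rewrite (modn_small t_lt).
have [s1 s2] : (s < n)%N /\ (s.+1 < n)%N by lia.
rewrite /neighbours /= !inE -(Eplus _ s1) -(Eplus _ s2).
rewrite -(Eminus _ s1) -(Eminus _ s2).
apply/existsP/idP => [[t]|].
  rewrite !inE => /andP[/orP[] /eqP->] /orP[] ->; by rewrite ?orbT.
case/or4P => H; [exists (vtx s) | exists (vtx s.+1) | exists (vtx s.+1)
  | exists (vtx s)]; by rewrite !inE eqxx H ?orbT.
Qed.

(** The bound [s.+1 < n./2] gives [s < s+1 < n-s-1 < n-s], and [0 < s] keeps all four offsets below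
    [n]. *)
Lemma neighbours_uniq i : uniq (neighbours i).
Proof.
rewrite map_inj_in_uniq; last first.
  have lt_n d : d \in offsets -> (d < n)%N by rewrite !inE; lia.
  move=> d d' /lt_n d_lt /lt_n d'_lt /(congr1 val)/= /eqP.
  by rewrite eqn_modDl !modn_small // => /eqP.
rewrite /= !inE; lia.
Qed.

Lemma Circ_consecutive_regular : regular 4 (Circ S).
Proof.
move=> i; have /card_uniqP := neighbours_uniq i; rewrite size_map /= => <-.
by apply: eq_card => j; rewrite inE Circ_consecutiveE.
Qed.

Lemma Circ_consecutive_simple : simple_graph (Circ S).
Proof.
split=> [i j | i].
  apply: eq_existsb => t; rewrite orbC; congr (_ && (_ || _)); exact: eq_sym.
rewrite Circ_consecutiveE; apply/negP => /mapP[d d_off /(congr1 val)/= /eqP].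
rewrite -{1}(modn_small (ltn_ord i)) -[X in X == _ %[mod _]]addn0 eqn_modDl.
have [d_gt0 d_lt] : (0 < d)%N /\ (d < n)%N by move: d_off; rewrite !inE; lia.
by rewrite mod0n modn_small //; lia.
Qed.

(** * The adjacency matrix and its kernel *)

Variable R : realType.

Let A := adjacency_mx R (Circ S).

Lemma adjacency_consecutive_sym : A^T = A.
Proof.
by apply/matrixP => i j; rewrite !mxE Circ_consecutive_simple.1.
Qed.

Lemma mul_adjacency_consecutive (u : 'rV[R]_n) (i : 'I_n) :
  (u *m A) 0 i = \sum_(d <- offsets) u 0 (vtx (i + d)).
Proof.
rewrite -adjacency_consecutive_sym mxE.
rewrite -(big_map (fun d => vtx (i + d)) predT (fun j => u 0 j)).
rewrite (big_uniq _ (neighbours_uniq i)) /= [RHS]big_mkcond.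
apply: eq_bigr => j _; rewrite !mxE Circ_consecutiveE -/(neighbours i).
by case: ifP => _; rewrite ?mulr1 ?mulr0.
Qed.

Let alt : 'rV[R]_n := \row_j (-1) ^+ (j : nat).

(** As [n] is even, reduction modulo [n] preserves parity. *)
Let alt_vtx k : alt 0 (vtx k) = (-1) ^+ k.
Proof.
rewrite mxE /= -signr_odd -[RHS]signr_odd {2}(divn_eq k n) oddD oddM.
by rewrite (negPf n_even) andbF.
Qed.

(** Two of the four offsets are even and two are odd, so the signs cancel. *)
Lemma mul_alternating_adjacency : alt *m A = 0.
Proof.
apply/rowP => i; rewrite mul_adjacency_consecutive mxE /offsets.
rewrite !big_cons big_nil !alt_vtx !exprD -(signr_odd _ (n - s.+1)).
rewrite -(signr_odd _ (n - s)).
have -> : odd (n - s.+1) = ~~ odd s by lia.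
have -> : odd (n - s) = odd s by lia.
rewrite -(signr_odd _ s) -(signr_odd _ s.+1) /=.
case: (odd s); rewrite /= ?expr0 ?expr1; ring.
Qed.

Hypothesis co_step : coprime s.*2.+1 n.

Lemma kernel_adjacency_consecutive (u : 'rV[R]_n) :
  u *m A = 0 -> exists c, u = c *: alt.
Proof.
move=> uA; pose f k := u 0 (vtx k).
have f_mod k l : k = l %[mod n] -> f k = f l.
  by move=> E; congr (u 0 _); apply: val_inj.
exists (f 0%N); apply/rowP => i; rewrite !mxE mulrC.
have -> : u 0 i = f i by congr (u 0 _); apply: val_inj; rewrite /= modn_small.
apply: (@alternating_of_recurrence _ n s.*2.+1) => //.
- by rewrite pnatr_eq0 -lt0n.
- by move=> k; apply: f_mod; rewrite modnDr.
(* The kernel equation is read at vertex [k + s + 1], whose neighbours are [k], [k + 1], [k + r] and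
   [k + r + 1] modulo [n], with [r = 2s + 1]. *)
move=> k; have /rowP/(_ (vtx (k + s.+1)%N)) := uA.
rewrite mul_adjacency_consecutive mxE /offsets !big_cons big_nil addr0 => <-.
have E d : u 0 (vtx (vtx (k + s.+1) + d)) = f (k + s.+1 + d)%N.
  by apply: f_mod; rewrite modnDml.
rewrite !E.
have -> : f (k + s.+1 + s)%N = f (k + s.*2.+1)%N by congr f; lia.
have -> : f (k + s.+1 + s.+1)%N = f (k + s.*2.+1).+1 by congr f; lia.
have -> : f (k + s.+1 + (n - s.+1))%N = f k.
  by rewrite -addnA subnKC; [apply: f_mod; rewrite modnDr | lia].
have -> : f (k + s.+1 + (n - s))%N = f k.+1.
  have -> : (k + s.+1 + (n - s) = k.+1 + n)%N by lia.
  by apply: f_mod; rewrite modnDr.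
ring.
Qed.

Lemma Circ_consecutive_nut : nut_graph R (Circ S).
Proof.
have alt_neq0 i : alt 0 i != 0 by rewrite mxE signr_eq0.
split; [exact: Circ_consecutive_simple | lia | |].
  apply: (@mup0_char_poly_line_kernel _ _ _ alt).
  - rewrite -/A -adjacency_consecutive_sym -trmx_mul.
    by rewrite mul_alternating_adjacency trmx0.
  (* The squared norm of [alt] is [n], nonzero in characteristic 0. *)
  - rewrite mxE (eq_bigr (fun=> 1)) => [|i _]; last first.
      by rewrite !mxE -expr2 sqrr_sign.
    by rewrite sumr_const card_ord pnatr_eq0 -lt0n.
  - exact: kernel_adjacency_consecutive.
exists alt; split=> //.
  by apply/eigenspaceP; rewrite scale0r mul_alternating_adjacency.
by apply: contraNneq (alt_neq0 (vtx 0)) => ->; rewrite mxE.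
Qed.

End ConsecutiveGenerators.

Theorem proposition16 (R : realType) (n : nat) (heven : ~~ odd n)
    (hn : (8 <= n)%N) :
  exists e : rel 'I_n, [/\ circulant e, regular 4 e & nut_graph R e].
Proof.
have [s [s_gt0 s_lt co_step]] := coprime_odd_step n heven hn.
exists (Circ (consecutive_generators n s s_lt)); split.
- exists (consecutive_generators n s s_lt) => //.
  exact: consecutive_generator_set.
- exact: Circ_consecutive_regular.
- exact: Circ_consecutive_nut.
Qed.
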